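(* Let $p$ be a prime with $p\equiv 1\pmod 4$, and let $b\ge 2$ be an integer with $p\nmid b$ such that the multiplicative order of $b$ modulo $p$ is $q=(p-1)/2$. Let $c_1,c_2,\ldots\in\{0,\ldots,b-1\}$ be the base-$b$ digits of $1/p$, i.e. $\frac1p=\sum_{j=1}^\infty c_jb^{-j}$, let $m=\frac1q\sum_{j=1}^q c_j$ and $\sigma^2=\frac1q\sum_{j=1}^q(c_j-m)^2$. Then $$\sigma^2=T(b,p)+\frac{2b}{p-1}\sum_{d\mid b}\frac{\chi(d)}{\phi(d)}\sum_{\psi\in X_d^-}\overline{\psi}(p)\,B_{\chi\psi}\,B_{\overline{\psi}},$$ where $T(b,p)=\frac{2b\,s(p,b)}{p-1}+\frac{(b-1)(bp-3b+p+3)}{12(p-1)}$.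
   Context: $s(p,b)=\sum_{k=1}^{b-1}((k/b))((pk/b))$ is the Dedekind sum, with $((x))=x-\lfloor x\rfloor-\tfrac12$ for $x\notin\mathbb{Z}$ and $((x))=0$ for $x\in\mathbb{Z}$. $\chi=\left(\frac{\cdot}{p}\right)$ is the Legendre symbol mod $p$ (an even Dirichlet character since $p\equiv1\bmod 4$). $\phi$ is Euler's function. For a positive integer $d$, $X_d^-$ denotes the set of odd Dirichlet characters modulo $d$ (empty if there are none); $\overline{\psi}$ is the complex conjugate character. For $\psi\in X_d^-$, $\chi\psi$ is the Dirichlet character mod $pd$ given by $\chi\psi(k)=\chi(k)\psi(k)$, and the Bernoulli numbers are $B_{\psi}=\frac1d\sum_{k=1}^{d-1}\psi(k)k$ (similarly $B_{\overline\psi}$) and $B_{\chi\psi}=\frac{1}{pd}\sum_{k=1}^{pd-1}\chi\psi(k)k$. *)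

(* Defs.v *)
From mathcomp Require Import all_boot all_order all_algebra.
From mathcomp Require Import all_fingroup all_solvable all_field all_character.
Set Implicit Arguments.
Unset Strict Implicit.
Unset Printing Implicit Defensive.
Import Order.TTheory GRing.Theory Num.Theory.
Local Open Scope ring_scope.

Definition sawtooth (x : rat) : rat :=
  if x \is a Num.int then 0 else x - (Num.floor x)%:~R - 2%:R^-1.

Definition dedekind_sum (p b : nat) : rat :=
  \sum_(1 <= k < b) sawtooth (k%:R / b%:R) * sawtooth (p%:R * k%:R / b%:R).

Definition legendre (p : nat) (k : int) : int :=
  if (p %| k)%Z then 0
  else if [exists x : 'F_p, x ^+ 2 == k%:~R] then 1 else -1.

(* The class of k in (Z/dZ)^*; the junk value 1 is returned when gcd(k, d) > 1.
   For d = 1 the type 'Z_1 is Z/2, whose unit group is trivial, as needed. *)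
Definition unit_class (d : nat) (k : int) : {unit 'Z_d} :=
  insubd (1%g : {unit 'Z_d}) (k%:~R : 'Z_d).

(* The Dirichlet characters mod d are the extensions by 0 of the morphisms from
   (Z/dZ)^* to the nonzero complex numbers. As this group is abelian, these
   morphisms are its irreducible characters, indexed by Iirr (units_Zp d), and
   their values are algebraic numbers. *)
Definition dchar (d : nat) (i : Iirr (units_Zp d)) (k : int) : algC :=
  if coprimez k d then 'chi_i (unit_class d k) else 0.

Definition odd_dchar (d : nat) (i : Iirr (units_Zp d)) : bool :=
  dchar i (-1) == -1.

(* B_f for a function f on the integers viewed modulo n. *)
Definition bernoulli1 (n : nat) (f : int -> algC) : algC :=
  n%:R^-1 * \sum_(1 <= k < n) f k%:Z * k%:R.

Definition T (b p : nat) : rat :=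
  2%:R * b%:R * dedekind_sum p b / (p%:R - 1)
  + (b%:R - 1) * (b%:R * p%:R - 3%:R * b%:R + p%:R + 3%:R)
    / (12%:R * (p%:R - 1)).

(* The textbook definition, used in dcharP, dchar_inj and dchar_surj to show that
   dchar enumerates the Dirichlet characters mod d without repetition. *)
Definition is_dirichlet_character (d : nat) (f : int -> algC) : Prop :=
  [/\ forall k, f (k + d%:Z) = f k,
      f 1 = 1,
      forall k l, f (k * l) = f k * f l
    & forall k, (f k != 0) = coprimez k d].

Lemma intr_unitZp (d : nat) (k : int) :
  (1 < d)%N -> ((k%:~R : 'Z_d) \is a GRing.unit) = coprimez k d.
Proof.
move=> d1; rewrite coprimezE absz_nat coprime_sym -unitZpE //.
by case: (intP k) => [|n|n] //=; rewrite mulrNz unitrN.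
Qed.

Lemma unit_classE (d : nat) (k : int) :
  (1 < d)%N -> coprimez k d -> val (unit_class d k) = k%:~R.
Proof. by move=> d1 ckd; rewrite insubdK // [_ \in _]intr_unitZp. Qed.

Lemma unit_Z1 (u v : {unit 'Z_1}) : u = v.
Proof.
suff one w : w = 1%g :> {unit 'Z_1} by rewrite [u]one [v]one.
have : w \in units_Zp 1 by rewrite inE.
by rewrite (card_le1_trivg (G := units_Zp_group 1)) ?card_units_Zp // => /set1P.
Qed.

Lemma coprimezDn (d : nat) (k : int) : coprimez (k + d%:Z) d = coprimez k d.
Proof. by rewrite !(coprimez_sym _ d) /coprimez gcdzDr. Qed.

Lemma unit_classDn (d : nat) (k : int) :
  (0 < d)%N -> coprimez k d -> unit_class d (k + d%:Z) = unit_class d k.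
Proof.
case: d => [|[|d]] // _ ckd; first exact: unit_Z1.
apply: val_inj; rewrite !unit_classE ?coprimezDn //.
by rewrite rmorphD /= [X in _ + X](pchar_Zp (p := d.+2)) ?addr0.
Qed.

Lemma unit_classM (d : nat) (k l : int) :
  (0 < d)%N -> coprimez k d -> coprimez l d ->
  unit_class d (k * l) = (unit_class d k * unit_class d l)%g.
Proof.
case: d => [|[|d]] // _ ckd cld; first exact: unit_Z1.
by apply: val_inj; rewrite /= !unit_classE ?coprimezMl ?ckd ?intrM.
Qed.

Lemma unit_class_eq (d : nat) (k l : int) :
  (0 < d)%N -> coprimez k d -> coprimez l d ->
  unit_class d k = unit_class d l -> (d %| k - l)%Z.
Proof.
case: d => [|[|d]] // _ ckd cld.
move/(congr1 val); rewrite !unit_classE // => /eqP.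
rewrite -subr_eq0 -intrB; case: (k - l) => n.
  by rewrite -pmulrn -val_eqE /= val_Zp_nat.
by rewrite NegzE mulrNz oppr_eq0 -pmulrn -val_eqE /= val_Zp_nat.
Qed.

Lemma unit_class_surj (d : nat) (u : {unit 'Z_d}) :
  (0 < d)%N -> exists2 k : int, coprimez k d & unit_class d k = u.
Proof.
case: d u => [|[|d]] // u _.
  by exists 1; [rewrite /coprimez gcd1z | exact: unit_Z1].
have uE : ((val u : nat)%:Z)%:~R = val u :> 'Z_d.+2 by exact: natr_Zp.
have cu : coprimez (val u : nat)%:Z d.+2.
  by rewrite -intr_unitZp // uE; exact: valP.
by exists (val u : nat)%:Z => //; apply: val_inj; rewrite unit_classE.
Qed.

Lemma dcharP (d : nat) (i : Iirr (units_Zp d)) :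
  (0 < d)%N -> is_dirichlet_character d (dchar i).
Proof.
move=> d0; have lin_i := char_abelianP _ (units_Zp_abelian d) i.
have c1 : coprimez 1 d by rewrite /coprimez gcd1z.
split=> [k||k l|k]; rewrite /dchar.
- by rewrite coprimezDn; case: ifP => // ckd; rewrite unit_classDn.
- have := unit_classM d0 c1 c1; rewrite c1 mulr1 => /esym.
  by rewrite -{3}[unit_class d 1]mulg1 => /mulgI ->; exact: lin_char1.
- rewrite coprimezMl; have [ckd|_] := boolP (coprimez k d); last first.
    by rewrite mul0r.
  have [cld|_] /= := boolP (coprimez l d); last by rewrite mulr0.
  by rewrite unit_classM // lin_charM ?inE.
- by case: ifP => _; rewrite ?eqxx // lin_char_neq0 ?inE.
Qed.

Lemma dchar_inj (d : nat) (i j : Iirr (units_Zp d)) :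
  (0 < d)%N -> dchar i =1 dchar j -> i = j.
Proof.
move=> d0 eq_ij; apply: irr_inj; apply/cfunP => u.
have [k ckd <-] := unit_class_surj u d0.
by have := eq_ij k; rewrite /dchar ckd.
Qed.

Lemma dchar_surj (d : nat) (f : int -> algC) :
  (0 < d)%N -> is_dirichlet_character d f ->
  exists i : Iirr (units_Zp d), dchar i =1 f.
Proof.
move=> d0 [fD f1 fM fN].
have fDn k (n : nat) : f (k + n%:Z * d%:Z) = f k.
  elim: n k => [|n IHn] k; first by rewrite (mul0r d%:Z : 0%:Z * d%:Z = 0) addr0.
  by rewrite -addn1 PoszD mulrDl mul1r addrA fD.
have fDM k (n : int) : f (k + n * d%:Z) = f k.
  case: n => n; first exact: fDn.
  by rewrite NegzE mulNr -[LHS](fDn _ n.+1) subrK.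
have f_class k l : coprimez k d -> coprimez l d ->
    unit_class d k = unit_class d l -> f k = f l.
  move=> ckd cld /(unit_class_eq d0 ckd cld) /dvdzP[n /eqP].
  by rewrite subr_eq addrC => /eqP ->; rewrite fDM.
have repr_ex u : exists k, coprimez k d && (unit_class d k == u).
  by have [k ckd /eqP uk] := unit_class_surj u d0; exists k; rewrite ckd.
pose r u : int := xchoose (repr_ex u).
have rP u : coprimez (r u) d /\ unit_class d (r u) = u.
  by have /andP[? /eqP] := xchooseP (repr_ex u).
have mxR : mx_repr (units_Zp d) (fun u => (f (r u))%:M : 'M[algC]_1).
  split=> [|u v _ _]; last rewrite -scalar_mxM -fM; congr (_ %:M).
  - rewrite -[RHS]f1; apply: f_class; rewrite ?(rP _).1 ?(rP _).2 //.
      by rewrite /coprimez gcd1z.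
    have c1 : coprimez 1 d by rewrite /coprimez gcd1z.
    have := unit_classM d0 c1 c1; rewrite mulr1.
    by rewrite -{1}[unit_class d 1]mulg1 => /mulgI.
  - apply: f_class; rewrite ?coprimezMl ?(rP _).1 ?unit_classM ?(rP _).1 //.
    by rewrite !(rP _).2.
pose rG := MxRepresentation mxR.
have lin_rG : cfRepr rG \is a linear_char.
  by rewrite qualifE /= cfRepr_char cfRepr1 eqxx.
have /irrP[i def_i] := lin_char_irr lin_rG.
exists i => k; rewrite /dchar; case: ifP => ckd; last first.
  by apply/esym/eqP/negPn; rewrite fN ckd.
rewrite -def_i cfunE inE mulr1n mxtrace_scalar mulr1n.
by apply: f_class; rewrite ?(rP _).1 ?(rP _).2.
Qed.

(* Main.v *)
(**
Write ((x)) for the sawtooth, c_t = floor(bt/p) and m = (b-1)/2. The digits of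
1/p are the numbers c_t with t = b^j mod p, and t runs over the quadratic
residues mod p because <b> is the index 2 subgroup of the cyclic group
(Z/p)^*. The symmetry c_(p-t) = b-1-c_t gives the mean m. The key identity is
  sum_(l mod b) ((l/b)) ((l/b + t/p))
    = (b-1)(b-2)/(12b) + ((c_t - m)^2 - m^2) / (2b),
which turns (c_t - m)^2 into a sum over l. Summing it over the residues, that
is against (1 + chi(t))/2, the trivial part collapses to s(p,b) by the
distribution relation sum_t ((x + t/p)) = ((px)) and produces T(b,p). The part
twisted by chi is the sum over l mod b of ((l/b)) sum_t chi(t) ((l/b + t/p)).
Sorting the fractions l/b by their reduced denominator d, the sums over l
coprime to d become the character sums, by orthogonality of the odd characters
mod d and the formula B_f = sum_k f(k) ((k/n)) for odd f of period n.
*)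

Require Import Defs.
From mathcomp Require Import all_boot all_order all_algebra.
From mathcomp Require Import all_fingroup all_solvable all_field all_character.
From mathcomp Require Import all_classical all_reals all_analysis.
From mathcomp Require Import ring lra zify.
Import Order.TTheory GRing.Theory Num.Theory.
Import numFieldNormedType.Exports.
Local Open Scope classical_set_scope.
Local Open Scope ring_scope.

Set Implicit Arguments.
Unset Strict Implicit.
Unset Printing Implicit Defensive.

(** * Sums and the sawtooth function *)

Lemma sum_periodic_shift (V : zmodType) (n s : nat) (f : nat -> V) :
  (forall k, f (k + n)%N = f k) ->
  \sum_(0 <= k < n) f (k + s)%N = \sum_(0 <= k < n) f k.
Proof.
move=> fn; elim: s => [|s IHs]; first by apply: eq_bigr => k _; rewrite addn0.
rewrite -IHs; case: n fn {IHs} => [|n] fn; first by rewrite !big_geq.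
rewrite big_nat_recr //= [RHS]big_nat_recl //= addrC; congr (_ + _).
  by rewrite -addSnnS addnC fn.
by apply: eq_bigr => k _; rewrite addSnnS.
Qed.

Lemma sum_nat_divmod (V : zmodType) (m n : nat) (f : nat -> V) :
  \sum_(0 <= k < m * n) f k =
  \sum_(0 <= t < m) \sum_(0 <= r < n) f (t * n + r)%N.
Proof.
rewrite big_nat_mul; apply: eq_bigr => t _.
rewrite -{1}[(t * n)%N]add0n big_addn mulSn addnK.
by apply: eq_bigr => r _; rewrite addnC.
Qed.

Lemma sum_nat_rev1 (V : zmodType) (n : nat) (f : nat -> V) :
  \sum_(1 <= k < n) f (n - k)%N = \sum_(1 <= k < n) f k.
Proof.
by rewrite [RHS]big_nat_rev; apply: eq_bigr => k _; rewrite add1n subSS.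
Qed.

Lemma sum_nat_id (F : numFieldType) (n : nat) :
  \sum_(0 <= k < n) k%:R = n%:R * (n%:R - 1) / 2 :> F.
Proof.
elim: n => [|n IHn]; first by rewrite big_geq // !mul0r.
by rewrite big_nat_recr //= IHn -natr1; field.
Qed.

Lemma sum_nat_sqr (F : numFieldType) (n : nat) :
  \sum_(0 <= k < n) k%:R ^+ 2 = n%:R * (n%:R - 1) * (2 * n%:R - 1) / 6 :> F.
Proof.
elim: n => [|n IHn]; first by rewrite big_geq // !mul0r.
by rewrite big_nat_recr //= IHn -natr1; field.
Qed.

Lemma sawtoothD1 (x : rat) : sawtooth (x + 1) = sawtooth x.
Proof.
rewrite /sawtooth rpredDr // floorDrz // floor1 intrD.
by case: ifP => // _; rewrite opprD addrACA subrr addr0.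
Qed.

Lemma sawtoothDn (x : rat) (n : nat) : sawtooth (x + n%:R) = sawtooth x.
Proof. by elim: n => [|n IHn]; rewrite ?addr0 // -natr1 addrA sawtoothD1. Qed.

Lemma sawtoothN (x : rat) : sawtooth (- x) = - sawtooth x.
Proof.
rewrite /sawtooth rpredN; case: ifP => [|xZ]; first by rewrite oppr0.
have -> : Num.floor (- x) = - Num.floor x - 1.
  have /andP[x_ge x_lt] := floor_itv x.
  have x_gt : (Num.floor x)%:~R < x.
    by rewrite lt_neqAle x_ge andbT -intrEfloor xZ.
  by apply: floor_def; rewrite subrK intrB !intrN intrD in x_lt *; lra.
by rewrite intrB intrN; field.
Qed.

Lemma sawtooth0 : sawtooth 0 = 0.
Proof. by rewrite /sawtooth rpred0. Qed.

Lemma sawtooth_frac (a d : nat) : (0 < d)%N ->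
  sawtooth (a%:R / d%:R) =
  if (d %| a)%N then 0 else (a %% d)%:R / d%:R - 2^-1.
Proof.
move=> d0; have d0' : (d%:R : rat) != 0 by rewrite pnatr_eq0 -lt0n.
rewrite {1}(divn_eq a d) natrD natrM mulrDl mulfK // addrC sawtoothDn.
have r_lt : (a %% d)%:R / d%:R < 1 :> rat.
  by rewrite ltr_pdivrMr ?ltr0n // mul1r ltr_nat ltn_mod.
have r_ge : 0 <= (a %% d)%:R / d%:R :> rat by rewrite divr_ge0 ?ler0n.
have fl0 : Num.floor ((a %% d)%:R / d%:R : rat) = 0.
  by apply: floor_def; rewrite add0r r_ge.
rewrite /sawtooth intrEfloor fl0 subr0.
by rewrite eq_sym mulf_eq0 invr_eq0 (negPf d0') orbF pnatr_eq0.
Qed.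

Lemma sawtooth_frac_lt (a d : nat) : (0 < a < d)%N ->
  sawtooth (a%:R / d%:R) = a%:R / d%:R - 2^-1.
Proof.
move=> /andP[a0 ad]; rewrite sawtooth_frac ?(ltn_trans a0) // gtnNdvd //.
by rewrite modn_small.
Qed.

(** With n l = N b + y, the t-th argument is (b (t + N) + y) / (b n). Periodicity absorbs the shift
    by [N]; for [t < n] the remaining fractions lie in [0, 1), where the sawtooth is affine away
    from 0. *)
Lemma sum_sawtooth_distrib (n b l : nat) : (0 < n)%N -> (0 < b)%N ->
  \sum_(0 <= t < n) sawtooth (l%:R / b%:R + t%:R / n%:R) =
  sawtooth (n%:R * l%:R / b%:R).
Proof.
move=> n0 b0.
have n0' : (n%:R : rat) != 0 by rewrite pnatr_eq0 -lt0n.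
have b0' : (b%:R : rat) != 0 by rewrite pnatr_eq0 -lt0n.
have bn0 : (0 < b * n)%N by rewrite muln_gt0 b0.
rewrite -natrM sawtooth_frac //.
set N := (n * l %/ b)%N; set y := (n * l %% b)%N.
have nlE : (n%:R * l%:R = N%:R * b%:R + y%:R :> rat).
  by rewrite -!natrM -natrD -divn_eq.
have y_lt : (y < b)%N by rewrite ltn_mod.
pose f (t : nat) := sawtooth ((b * t + y)%:R / (b * n)%:R).
have fP t : f (t + n)%N = f t.
  rewrite /f mulnDr addnAC natrD mulrDl divff ?sawtoothD1 //.
  by rewrite pnatr_eq0 -lt0n.
rewrite (eq_bigr (fun t => f (t + N)%N)) => [|t _]; last first.
  rewrite /f; congr sawtooth; rewrite mulnDr !natrD !natrM.
  apply: (mulfI n0'); apply: (mulfI b0').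
  by field: nlE; rewrite n0' b0'.
rewrite sum_periodic_shift // -/(dvdn b (n * l)) /dvdn -/y.
have f_val t : (t < n)%N -> (0 < b * t + y)%N ->
    f t = (t%:R + y%:R / b%:R) / n%:R - 2^-1.
  move=> tn ty0; rewrite /f sawtooth_frac_lt ?ty0 /=; last by nia.
  by rewrite natrD !natrM; field; rewrite n0' b0'.
(* For [y = 0] the term [t = 0] is ((0)) = 0 instead of -1/2, so it is split off. *)
case: (posnP y) => [y0|y0].
  rewrite big_ltn // {1}/f y0 muln0 mul0r sawtooth0 add0r.
  have -> : \sum_(1 <= t < n) f t = \sum_(1 <= t < n) (t%:R / n%:R - 2^-1).
    apply: eq_big_nat => t /andP[t0 tn]; rewrite f_val //; last by nia.
    by rewrite y0 mul0r addr0.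
  have := sum_nat_id rat n; rewrite big_ltn // add0r => sE.
  rewrite big_split /= -mulr_suml sE sumr_const_nat.
  rewrite -[(- _) *+ _]mulr_natr natrB //.
  by field.
rewrite (eq_big_nat _ _
  (F2 := fun t => t%:R / n%:R + (y%:R / b%:R / n%:R - 2^-1))).
  rewrite big_split /= -mulr_suml sum_nat_id sumr_const_nat subn0.
  rewrite -[(_ - _) *+ _]mulr_natr.
  by field; rewrite n0' b0'.
move=> t /andP[_ tn]; rewrite f_val //; last by rewrite addn_gt0 y0 orbT.
by field; rewrite n0' b0'.
Qed.

(** The argument lies strictly between 0 and 2 and reaches 1 exactly when l >= b - floor(b t / p).
    As [p] does not divide [b * t], it is never an integer. *)
Lemma sawtooth_add_frac (p b l t : nat) :
  (0 < l < b)%N -> (0 < t < p)%N -> ~~ (p %| b * t)%N ->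
  sawtooth (l%:R / b%:R + t%:R / p%:R) =
  l%:R / b%:R + t%:R / p%:R - 2^-1 - (b - b * t %/ p <= l)%N%:R.
Proof.
move=> /andP[l0 lb] /andP[t0 tp] pNbt.
have p0 : (0 < p)%N by apply: leq_trans tp.
have b0 : (0 < b)%N by apply: leq_trans lb.
have p0' : (p%:R : rat) != 0 by rewrite pnatr_eq0 -lt0n.
have b0' : (b%:R : rat) != 0 by rewrite pnatr_eq0 -lt0n.
have sumE : l%:R / b%:R + t%:R / p%:R =
    (l * p + b * t)%N%:R / (b * p)%N%:R :> rat.
  by rewrite natrD !natrM; field; rewrite p0' b0'.
have ltE : (b - b * t %/ p <= l)%N = (b * p <= l * p + b * t)%N.
  by rewrite leq_subLR addnC -leq_subLR leq_divRL // mulnBl leq_subLR.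
have Ndvd : ~~ (b * p %| l * p + b * t)%N.
  apply: contra pNbt => /(dvdn_trans (dvdn_mull b (dvdnn p))).
  by rewrite dvdn_addr // dvdn_mull.
rewrite sumE ltE; have [le_bp|gt_bp] := leqP.
  rewrite -[X in (X%:R / _)](subnK le_bp) natrD mulrDl divff; last first.
    by rewrite natrM mulf_neq0.
  rewrite sawtoothD1 sawtooth_frac_lt.
    by rewrite /=; field; rewrite p0' b0'.
  rewrite subn_gt0 ltn_neqAle le_bp andbT; apply/andP; split.
    by apply: contraNneq Ndvd => ->.
  by nia.
by rewrite sawtooth_frac_lt ?subr0 // gt_bp andbT addn_gt0 muln_gt0 l0 p0.
Qed.

(** For 0 < l < b, ((l/b + t/p)) is ((l/b)) + t/p, lowered by 1 at the last c = floor(b t / p)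
    values of l. The t/p term drops out because the ((l/b)) sum to 0, and the lowering costs the sum
    of l/b - 1/2 over those values, which is c (b - 1 - c) / (2b). *)
Lemma sum_sawtooth_digit (p b t : nat) :
  (0 < t < p)%N -> ~~ (p %| b * t)%N ->
  \sum_(0 <= l < b)
    sawtooth (l%:R / b%:R) * sawtooth (l%:R / b%:R + t%:R / p%:R) =
  (b%:R - 1) * (b%:R - 2) / (12 * b%:R)
  + (((b * t %/ p)%:R - (b%:R - 1) / 2) ^+ 2 - ((b%:R - 1) / 2) ^+ 2)
    / (2 * b%:R).
Proof.
move=> tp pNbt; have /andP[t0 t_lt] := tp.
have p0 : (0 < p)%N by apply: leq_trans t_lt.
have b0 : (0 < b)%N by case: b pNbt; rewrite ?dvdn0.
have p0' : (p%:R : rat) != 0 by rewrite pnatr_eq0 -lt0n.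
have b0' : (b%:R : rat) != 0 by rewrite pnatr_eq0 -lt0n.
set c := (b * t %/ p)%N.
have c_lt : (c < b)%N by rewrite ltn_divLR // ltn_pmul2l.
have c_sub : (0 < b - c)%N by rewrite subn_gt0.
rewrite big_ltn // mul0r sawtooth0 mul0r add0r.
rewrite (eq_big_nat _ _ (F2 := fun l =>
   (b%:R ^- 2 * l%:R ^+ 2 + (t%:R / p%:R - 1) / b%:R * l%:R
     + (2^-1 - t%:R / p%:R) / 2)
   - (if (b - c <= l)%N then l%:R / b%:R - 2^-1 else 0))); last first.
  move=> l lb; rewrite sawtooth_frac_lt // sawtooth_add_frac // -/c.
  by case: ifP => _; rewrite /=; field; rewrite p0' b0'.
have sum1 (F : nat -> rat) n : (0 < n)%N ->
    \sum_(1 <= l < n) F l = \sum_(0 <= l < n) F l - F 0%N.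
  by move=> n0; rewrite [in RHS]big_ltn // [RHS]addrC addKr.
have lin n : (0 < n)%N -> \sum_(1 <= l < n) (l%:R / b%:R - 2^-1) =
    n%:R * (n%:R - 1) / 2 / b%:R - (n%:R - 1) / 2 :> rat.
  move=> n0; rewrite big_split /= -mulr_suml (sum1 (fun l => l%:R)) // sum_nat_id.
  by rewrite sumr_const_nat -[(- _) *+ _]mulr_natr natrB //; field.
rewrite sumrB -big_mkcond /=.
have -> : \sum_(1 <= l < b | (b - c <= l)%N) (l%:R / b%:R - 2^-1 : rat) =
   \sum_(b - c <= l < b) (l%:R / b%:R - 2^-1).
  by rewrite [RHS](big_nat_widenl _ 1).
have -> : \sum_(b - c <= l < b) (l%:R / b%:R - 2^-1) =
   \sum_(1 <= l < b) (l%:R / b%:R - 2^-1)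
     - \sum_(1 <= l < b - c) (l%:R / b%:R - 2^-1) :> rat.
  by rewrite (@big_cat_nat _ _ _ (b - c) 1 b) ?leq_subr //= [RHS]addrC addKr.
rewrite !lin // natrB; last exact: ltnW.
rewrite !big_split /= -!mulr_sumr (sum1 (fun l => l%:R ^+ 2)) //.
rewrite (sum1 (fun l => l%:R)) //.
rewrite sum_nat_id sum_nat_sqr sumr_const_nat -[_ *+ (b - 1)]mulr_natr natrB //.
by field; rewrite p0' b0'.
Qed.

(** * The Legendre symbol *)

Section HalfCycle.
Variables (gT : finGroupType) (G : {group gT}) (u : gT).
Hypotheses (cycG : cyclic G) (Gu : u \in G) (oG : #|G| = (2 * #[u]%g)%N).

(** A cyclic group has only one subgroup of each order dividing its own. *)
Lemma half_cycle_generator :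
  exists2 g, G = <[g]>%G & <[u]>%g = <[g ^+ 2]>%g.
Proof.
have [g defG] := cyclicP cycG.
exists g; first exact: val_inj.
have og : #[g]%g = (2 * #[u]%g)%N by rewrite orderE -defG.
apply/eqP; rewrite (eq_subG_cyclic cycG) ?cycle_subG //; last first.
  by rewrite groupX // defG cycle_id.
rewrite -!orderE orderXdiv og ?dvdn_mulr // mulKn //.
Qed.

Lemma mem_half_cycle_sqr (x : gT) :
  x \in G -> (x \in <[u]>%g) = [exists y in G, (y ^+ 2)%g == x].
Proof.
have [g defG ->] := half_cycle_generator => Gx.
apply/idP/exists_inP => [/cycleP[i ->]|[y Gy /eqP <-]].
  exists (g ^+ i)%g; first by rewrite defG mem_cycle.
  by rewrite -!expgM mulnC.
move: Gy; rewrite defG => /cycleP[i ->].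
by rewrite -expgM mulnC expgM mem_cycle.
Qed.

(** For powers of a generator, membership in [<[u]>] means an even exponent, and parities add. *)
Lemma mem_half_cycleM (x y : gT) : x \in G -> y \in G ->
  ((x * y)%g \in <[u]>%g) = ((x \in <[u]>%g) == (y \in <[u]>%g)).
Proof.
have [g defG uE] := half_cycle_generator.
have logE i : ((g ^+ i)%g \in <[u]>%g) = ~~ odd i.
  rewrite uE -[i in LHS]odd_double_half addnC expgD -muln2 mulnC expgM.
  rewrite groupMl ?mem_cycle //.
  case: (odd i); last by rewrite group1.
  (* Otherwise [g], hence all of [G], would lie in a subgroup of half its order. *)
  apply/negP=> g2g; have: (#|G| <= #[u]%g)%N.
    by rewrite orderE uE; apply: subset_leq_card; rewrite defG cycle_subG.
  by rewrite oG mul2n -addnn leqNgt -{1}[#[u]%g]add0n ltn_add2r order_gt0.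
rewrite defG => /cycleP[i ->] /cycleP[j ->]; rewrite -expgD !logE oddD.
by case: (odd i); case: (odd j).
Qed.
End HalfCycle.

Section Legendre.
Variable p : nat.
Hypotheses (p_prime : prime p) (p_odd : odd p).

Let p_gt1 : (1 < p)%N := prime_gt1 p_prime.
Let p_gt0 : (0 < p)%N := prime_gt0 p_prime.

Lemma coprimez_prime (k : int) : coprimez k p = ~~ (p %| k)%Z.
Proof. by rewrite coprimezE coprime_sym prime_coprime // dvdzE. Qed.

Lemma unit_class_modn (a : nat) :
  coprimez a p -> unit_class p (a %% p)%N = unit_class p a.
Proof.
move=> cap; apply: val_inj.
have cmod : coprimez (a %% p)%N p by rewrite coprimezE /= coprime_modl.
rewrite !unit_classE //; apply: val_inj.
by rewrite -!pmulrn [LHS](val_Zp_nat p_gt1) [RHS](val_Zp_nat p_gt1) modn_mod.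
Qed.

Lemma unit_class_eqP (a c : nat) : coprimez a p -> coprimez c p ->
  reflect (a = c %[mod p]) (unit_class p a == unit_class p c).
Proof.
move=> cap ccp; apply: (iffP eqP) => [|ac]; last first.
  by rewrite -(unit_class_modn cap) ac unit_class_modn.
move/(congr1 val); rewrite !unit_classE // -!pmulrn => /(congr1 val) ac.
by rewrite -(val_Zp_nat p_gt1 a) -(val_Zp_nat p_gt1 c); exact: ac.
Qed.

(** ['F_p] unfolds to ['Z_(pdiv p)]; for a prime this moves the symbol to the ring in which
    [unit_class] lives. *)
Lemma legendre_Zp (k : int) : legendre p k =
  if (p %| k)%Z then 0
  else if [exists x : 'Z_p, x ^+ 2 == k%:~R] then 1 else -1.
Proof. by rewrite /legendre pdiv_id. Qed.

(** The squares form the unique subgroup of index 2. Keeping [u] arbitrary serves both the general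
    properties of the symbol and the case of the class of [b]. *)
Lemma legendre_half_cycle (u : {unit 'Z_p}) (k : int) :
  (p - 1 = 2 * #[u]%g)%N -> coprimez k p ->
  legendre p k = (-1) ^+ (unit_class p k \notin <[u]>%g).
Proof.
move=> ou ckp; rewrite legendre_Zp -if_neg -coprimez_prime ckp.
have oG : #|units_Zp p| = (2 * #[u]%g)%N.
  by rewrite card_units_Zp // totient_prime // -subn1.
rewrite (mem_half_cycle_sqr (units_Zp_cyclic p_prime) _ oG) ?inE //.
suff -> : [exists x : 'Z_p, x ^+ 2 == k%:~R] =
    [exists y in units_Zp p, (y ^+ 2)%g == unit_class p k].
  by case: ifP.
apply/existsP/exists_inP => [[x /eqP xk]|[y _ /eqP yk]].
  have ux : x \is a GRing.unit.
    by rewrite -(unitrX_pos _ (n := 2)) // xk intr_unitZp.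
  exists (FinRing.unit _ ux); first by rewrite inE.
  by apply/eqP/val_inj; rewrite /= unit_classE // -xk expr2.
by exists (val y); rewrite -(unit_classE _ ckp) // -yk /= expr2.
Qed.

Lemma ex_half_order : exists u : {unit 'Z_p}, (p - 1 = 2 * #[u]%g)%N.
Proof.
have [g defG] := cyclicP (units_Zp_cyclic p_prime).
have og : #[g]%g = (p - 1)%N.
  by rewrite orderE -defG card_units_Zp // totient_prime // subn1.
have p1 : (2 %| p - 1)%N by rewrite dvdn2 oddB // p_odd.
by exists (g ^+ 2)%g; rewrite orderXdiv og // mulnC divnK.
Qed.

Lemma legendreM (k l : int) : legendre p (k * l) = legendre p k * legendre p l.
Proof.
have [ckp|] := boolP (coprimez k p); last first.
  by rewrite coprimez_prime negbK /legendre => pk; rewrite dvdz_mulr // pk mul0r.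
have [clp|] := boolP (coprimez l p); last first.
  by rewrite coprimez_prime negbK /legendre => pl; rewrite dvdz_mull // pl mulr0.
have [u ou] := ex_half_order.
have oG : #|units_Zp p| = (2 * #[u]%g)%N.
  by rewrite card_units_Zp // totient_prime // -subn1.
rewrite !(legendre_half_cycle ou) ?coprimezMl ?ckp // unit_classM //.
rewrite (mem_half_cycleM (units_Zp_cyclic p_prime) _ oG) ?inE //.
by case: (_ \in _); case: (_ \in _).
Qed.

Lemma legendre0 : legendre p 0 = 0.
Proof. by rewrite /legendre dvdz0. Qed.

Lemma legendreDp (k : int) : legendre p (k + p) = legendre p k.
Proof.
have p0 : (p%:~R : 'Z_p) = 0 by exact: pchar_Zp.
by rewrite !legendre_Zp rpredDr // intrD p0 addr0.
Qed.

Lemma legendre_sqr (k : int) : ~~ (p %| k)%Z -> legendre p k ^+ 2 = 1.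
Proof.
by rewrite /legendre => /negPf ->; case: ifP => _; rewrite ?sqrrN expr1n.
Qed.

Hypothesis p_mod4 : p = 1 %[mod 4].

(** For p = 1 mod 4 the order (p - 1)/2 of [u] is even, so [<[u]>] contains the only subgroup of
    order 2 of the cyclic unit group, which is generated by -1. *)
Lemma legendreN (k : int) : legendre p (- k) = legendre p k.
Proof.
rewrite -mulN1r legendreM -[RHS]mul1r; congr (_ * _).
have cN1 : coprimez (-1) p by rewrite coprimezE abszN1 coprime1n.
have [u ou] := ex_half_order.
rewrite (legendre_half_cycle ou) //.
suff -> : unit_class p (-1) \in <[u]>%g by [].
have q2 : (2 %| #[u]%g)%N.
  move: p_mod4 ou (divn_eq p 4) p_gt1 => -> ; lia.
have wE : #[unit_class p (-1)]%g = 2.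
  apply: nt_prime_order => //.
    by apply: val_inj; rewrite /= unit_classE // mulrNN mulr1.
  (* If -1 were equal to 1, then [p] would divide 2. *)
  apply/eqP => /(congr1 val); rewrite unit_classE //= => /eqP.
  rewrite eq_sym -subr_eq0 opprK -[1 + 1]/(2%:R) => /eqP p2.
  have := val_Zp_nat p_gt1 2; rewrite p2 => /esym/eqP/dvdn_leq {}p2.
  by move: p_odd p_gt1 (p2 isT); case: (p) => [|[|[|[]]]].
have vE : #[u ^+ (#[u] %/ 2)]%g = 2.
  rewrite orderXdiv ?dvdn_div //.
  by rewrite -{1}(divnK q2) mulKn // divn_gt0 // dvdn_leq // order_gt0.
have : <[unit_class p (-1)]>%g = <[u ^+ (#[u] %/ 2)]>%g.
  apply/eqP; rewrite (eq_subG_cyclic (units_Zp_cyclic p_prime)).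
  - by rewrite -!orderE wE vE.
  - by rewrite cycle_subG inE.
  - by rewrite cycle_subG inE.
by move=> eq_w; rewrite -cycle_subG eq_w cycle_subG mem_cycle.
Qed.
End Legendre.

(** Both index lists enumerate, without repetition, the subgroup generated by [b], which consists of
    the squares. *)
Lemma sum_half_cycle (V : zmodType) (p b : nat) (g : nat -> V) :
  prime p -> ~~ (p %| b)%N -> (p - 1 = 2 * #[unit_class p b]%g)%N ->
  \sum_(0 <= j < #[unit_class p b]%g) g (b ^ j %% p)%N =
  \sum_(1 <= t < p | legendre p t == 1) g t.
Proof.
move=> p_prime pNb; set u := unit_class p b => ou.
have p_gt1 := prime_gt1 p_prime; have p_gt0 := prime_gt0 p_prime.
have cbX j : coprimez (b ^ j)%N p.
  rewrite coprimez_prime // dvdzE /=; case: j => [|j].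
    by rewrite dvdn1 neq_ltn p_gt1 orbT.
  by rewrite Euclid_dvdX // andbT.
have uX j : unit_class p (b ^ j)%N = (u ^+ j)%g.
  elim: j => [|j IHj].
    apply: val_inj; exact: (unit_classE p_gt1 (cbX 0%N)).
  have cb := cbX 1%N; rewrite expn1 in cb.
  by rewrite expnS PoszM unit_classM // IHj expgS.
rewrite -[RHS]big_filter -(big_map (fun j => b ^ j %% p)%N predT g).
apply: perm_big; apply: uniq_perm.
- rewrite map_inj_in_uniq ?iota_uniq // => i j.
  rewrite !mem_index_iota /= => i_lt j_lt
    /(unit_class_eqP p_prime (cbX _) (cbX _)).
  by rewrite !uX eq_expg_mod_order !modn_small // => /eqP.
- by rewrite filter_uniq // iota_uniq.
move=> t; rewrite mem_filter mem_index_iota; apply/mapP/idP => [[j]|].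
  rewrite mem_index_iota /= => j_lt ->.
  have cj : coprimez (b ^ j %% p)%N p.
    by have := cbX j; rewrite !coprimezE /= coprime_modl.
  rewrite ltn_mod p_gt0 andbT (legendre_half_cycle p_prime ou) //.
  rewrite unit_class_modn // uX mem_cycle /= lt0n.
  by have := cbX j; rewrite coprimez_prime // dvdzE.
case/and3P=> /eqP lt1 t0 tp.
have ct : coprimez t p by rewrite coprimez_prime // dvdzE /= gtnNdvd.
move: lt1; rewrite (legendre_half_cycle p_prime ou) //.
case: (boolP (_ \in _)) => // /cyclePmin[j j_lt tj] _.
exists j; first by rewrite mem_index_iota.
rewrite -(modn_small tp); apply/(unit_class_eqP p_prime ct (cbX _)).
by rewrite uX tj.
Qed.

(** * Dirichlet characters and Bernoulli numbers *)

Lemma big_pred1_uniq_seq (V : zmodType) (I : eqType) (r : seq I) (x : I)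
    (F : I -> V) :
  uniq r -> x \in r -> \sum_(i <- r | i == x) F i = F x.
Proof. by move=> r_uniq xr; rewrite -big_filter filter_pred1_uniq // big_seq1. Qed.

(** Each [l < b] is counted for exactly one divisor, the reduced denominator b / gcd(l, b) of l/b;
    [l = 0] goes to [d = 1]. *)
Lemma sum_divisors_coprime (V : zmodType) (b : nat) (f : rat -> V) :
  (0 < b)%N ->
  \sum_(d <- divisors b) \sum_(0 <= l < d | coprime l d) f (l%:R / d%:R) =
  \sum_(0 <= l < b) f (l%:R / b%:R).
Proof.
move=> b0.
transitivity (\sum_(0 <= l < b) \sum_(d <- divisors b | d == (b %/ gcdn l b)%N)
    f (l%:R / b%:R)); last first.
  apply: eq_bigr => l _; rewrite big_pred1_uniq_seq ?divisors_uniq //.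
  by rewrite -dvdn_divisors // dvdn_div // dvdn_gcdr.
rewrite (exchange_big_dep predT) //= big_seq [RHS]big_seq.
apply: eq_bigr => d; rewrite -dvdn_divisors // => /dvdnP[e].
rewrite mulnC => bE.
move: b0; rewrite {b}bE muln_gt0 => /andP[d0 e0].
rewrite [RHS]big_mkcond sum_nat_divmod big_mkcond /=.
apply: eq_bigr => l _; case: e e0 => // e _.
(* With b = d e and the index written l e + r, r < e, a term with r > 0 cannot have reduced
   denominator d, since e would then divide r. *)
rewrite big_nat_recl //= addn0 [X in _ + X]big1_seq ?addr0 => [|r]; last first.
  rewrite mem_index_iota => /andP[_ r_lt]; case: eqP => // dE.
  have : (e.+1 %| gcdn (l * e.+1 + r.+1) (d * e.+1))%N.
    have := divnK (dvdn_gcdr (l * e.+1 + r.+1) (d * e.+1)).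
    by rewrite -dE => /eqP; rewrite eqn_pmul2l // => /eqP ->.
  move/dvdn_trans/(_ (dvdn_gcdl _ _)).
  by rewrite dvdn_addr ?dvdn_mull // gtnNdvd.
rewrite -muln_gcdl divnMr //.
have -> : (d == d %/ gcdn l d)%N = coprime l d.
  rewrite /coprime -{1}[d]divn1; apply/eqP/eqP => [dE|->//].
  have := divnK (dvdn_gcdr l d); rewrite -dE divn1.
  by rewrite -{3}[d]muln1 => /eqP; rewrite eqn_pmul2l // => /eqP.
case: ifP => // _; congr f; rewrite !natrM.
by field; rewrite nat1r !pnatr_eq0 -!lt0n d0.
Qed.

(** The members in range are t d + (a mod d); replacing a mod d by [a] shifts [t] by [a %/ d], which
    periodicity absorbs. *)
Lemma sum_congruence_class (V : zmodType) (p d a : nat) (h : nat -> V) :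
  (0 < d)%N -> (forall k, h (k + p * d)%N = h k) ->
  \sum_(0 <= k < p * d | k == a %[mod d]) h k =
  \sum_(0 <= t < p) h (a + t * d)%N.
Proof.
move=> d0 hP; rewrite big_mkcond sum_nat_divmod.
pose f t := h (t * d + a %% d)%N.
transitivity (\sum_(0 <= t < p) f t).
  apply: eq_bigr => t _; rewrite -big_mkcond /=.
  rewrite big_nat_cond (eq_bigl (fun r => r == a %% d)%N) => [|r].
    rewrite big_pred1_uniq_seq ?iota_uniq //.
    by rewrite mem_index_iota ltn_mod d0.
  rewrite leq0n modnMDl /=; apply/andP/eqP => [[r_lt /eqP]|->].
    by rewrite modn_small.
  by rewrite ltn_mod d0 modn_mod.
rewrite -(@sum_periodic_shift _ p (a %/ d)%N) => [|t]; last first.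
  by rewrite /f mulnDl addnAC hP.
apply: eq_bigr => t _; rewrite /f {3}(divn_eq a d); congr h.
by rewrite mulnDl -addnA addnC.
Qed.

(** The two sides differ by half the sum of [f] over a period, which vanishes by pairing k with n -
    k. *)
Lemma bernoulli1_sawtooth (n : nat) (f : int -> algC) : (0 < n)%N ->
  (forall k, f (k + n%:Z) = f k) -> (forall k, f (- k) = - f k) ->
  bernoulli1 n f =
  \sum_(0 <= k < n) f k%:Z * ratr (sawtooth (k%:R / n%:R)).
Proof.
move=> n0 fP fN; have n0' : (n%:R : algC) != 0 by rewrite pnatr_eq0 -lt0n.
rewrite [RHS]big_ltn // mul0r sawtooth0 [ratr 0]rmorph0 mulr0 add0r.
rewrite /bernoulli1 mulr_sumr.
have sum0 : \sum_(1 <= k < n) f k%:Z = 0.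
  have : \sum_(1 <= k < n) f k%:Z = - \sum_(1 <= k < n) f k%:Z.
    rewrite -{1}sum_nat_rev1 -sumrN; apply: eq_big_nat => k /andP[_ k_lt].
    by rewrite -fN -subzn 1?ltnW // addrC fP.
  by move/eqP; rewrite -addr_eq0 -mulr2n mulrn_eq0 => /eqP.
transitivity (\sum_(1 <= k < n) n%:R^-1 * (f k%:Z * k%:R)
    - 2^-1 * \sum_(1 <= k < n) f k%:Z).
  by rewrite sum0 mulr0 subr0.
rewrite mulr_sumr -sumrB; apply: eq_big_nat => k k_lt.
rewrite sawtooth_frac_lt // rmorphB fmorph_div fmorphV /= !ratr_nat.
by field.
Qed.

Section DirichletOrthogonality.
Variable d : nat.
Hypothesis d_gt0 : (0 < d)%N.

Lemma unit_class_eqz (k l : int) : coprimez k d -> coprimez l d ->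
  (unit_class d k == unit_class d l) = (d %| k - l)%Z.
Proof.
move=> ckd cld; apply/eqP/idP => [|/dvdzP[n /eqP]]; first exact: unit_class_eq.
rewrite subr_eq => /eqP kE.
case: d d_gt0 ckd cld kE => [|[|e]] // _ ckd cld kE; first exact: unit_Z1.
apply: val_inj; rewrite !unit_classE // kE intrD intrM.
by rewrite [X in _ * X](pchar_Zp (p := e.+2)) // mulr0 add0r.
Qed.

Lemma coprimez_congr (k l : int) : (d %| k - l)%Z -> coprimez k d = coprimez l d.
Proof.
move=> /dvdzP[n /eqP]; rewrite subr_eq => /eqP ->.
by rewrite !(coprimez_sym _ d) /coprimez gcdzMDl.
Qed.

(** Second orthogonality relation: in an abelian group each centralizer is the whole group, of order
    [totient d], and conjugate elements are equal. *)
Lemma sum_dchar_conj (k l : int) :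
  \sum_(i : Iirr (units_Zp d)) dchar i k * (dchar i l)^* =
  (totient d)%:R *+ (coprimez l d && (d %| k - l)%Z) :> algC.
Proof.
have [cld|Ncl] /= := boolP (coprimez l d); last first.
  by rewrite big1 // => i _; rewrite /dchar (negPf Ncl) rmorph0 mulr0.
have [ckd|Nck] := boolP (coprimez k d); last first.
  rewrite big1 => [|i _]; last by rewrite /dchar (negPf Nck) mul0r.
  have [/coprimez_congr|//] := boolP (d %| k - l)%Z.
  by rewrite (negPf Nck) cld.
rewrite -unit_class_eqz //.
under eq_bigr => i _ do rewrite /dchar ckd cld.
rewrite (second_orthogonality_relation (G := units_Zp_group d)) ?inE //.
have abG := units_Zp_abelian d.
have -> : 'C_(units_Zp d)[unit_class d k]%g = units_Zp d.
  apply/finset.setIidPl; apply: fintype.subset_trans abG _.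
  by rewrite -cent_set1 centS // finset.sub1set inE.
by rewrite card_units_Zp // (abelian_classP _ abG) ?inE.
Qed.

Lemma dcharN1 (i : Iirr (units_Zp d)) :
  dchar i (-1) = if odd_dchar i then -1 else 1.
Proof.
rewrite /odd_dchar; case: eqP => // /eqP neqN1; apply/eqP.
have [_ f1 fM _] := dcharP i d_gt0.
have : dchar i (-1) ^+ 2 == 1 by rewrite expr2 -fM mulrNN mulr1 f1.
by rewrite sqrf_eq1 (negPf neqN1) orbF.
Qed.

Lemma dcharN (i : Iirr (units_Zp d)) (k : int) :
  odd_dchar i -> dchar i (- k) = - dchar i k.
Proof.
have [_ _ fM _] := dcharP i d_gt0.
by move=> i_odd; rewrite -mulN1r fM dcharN1 i_odd mulN1r.
Qed.

Lemma sum_odd_dchar_conj (k l : int) :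
  \sum_(i : Iirr (units_Zp d) | odd_dchar i) dchar i k * (dchar i l)^* =
  (totient d)%:R / 2 * (coprimez l d)%:R
    * ((d %| k - l)%Z%:R - (d %| k + l)%Z%:R) :> algC.
Proof.
have -> : \sum_(i : Iirr (units_Zp d) | odd_dchar i) dchar i k * (dchar i l)^* =
    2^-1 * (\sum_(i : Iirr (units_Zp d)) dchar i k * (dchar i l)^*
      - \sum_(i : Iirr (units_Zp d)) dchar i (- k) * (dchar i l)^*).
  (* The weight (1 - psi(-1)) / 2 selects the odd characters. *)
  rewrite -sumrB mulr_sumr big_mkcond; apply: eq_bigr => i _.
  have [_ _ fM _] := dcharP i d_gt0.
  rewrite -[- k]mulN1r fM dcharN1.
  by case: ifP => _; [field | rewrite mul1r subrr mulr0].
rewrite !sum_dchar_conj -opprD [(d %| - _)%Z]rpredN.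
rewrite -[_ *+ (_ && (d %| k - l)%Z)]mulr_natr.
rewrite -[_ *+ (_ && (d %| k + l)%Z)]mulr_natr.
rewrite -!mulnb !natrM.
by ring.
Qed.
End DirichletOrthogonality.

(** * Sums twisted by the Legendre symbol *)

Section TwistedSum.
Variable p : nat.
Hypotheses (p_prime : prime p) (p_odd : odd p) (p_mod4 : p = 1 %[mod 4]).

Lemma legendreDMp (k : int) (n : nat) :
  legendre p (k + (n * p)%N) = legendre p k.
Proof.
elim: n => [|n IHn]; first by rewrite addr0.
by rewrite mulSnr PoszD addrA legendreDp.
Qed.

(** The chi-twisted analogue of the left side of [sum_sawtooth_distrib]. *)
Definition legendre_sawtooth (x : rat) : rat :=
  \sum_(0 <= t < p) (legendre p t)%:~R * sawtooth (x + t%:R / p%:R).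

(** On the representatives p l + t d with t < p, chi takes the value chi(t) chi(d), and division by
    p d gives l/d + t/p. *)
Lemma sum_legendre_class (d l : nat) : (0 < d)%N ->
  \sum_(0 <= k < p * d | k == p * l %[mod d])
    (legendre p k)%:~R * sawtooth (k%:R / (p * d)%:R) =
  (legendre p d)%:~R * legendre_sawtooth (l%:R / d%:R).
Proof.
move=> d0; have p0 := prime_gt0 p_prime.
have p0' : (p%:R : rat) != 0 by rewrite pnatr_eq0 -lt0n.
have d0' : (d%:R : rat) != 0 by rewrite pnatr_eq0 -lt0n.
rewrite (sum_congruence_class _ d0) => [|k]; last first.
  rewrite {1}[(p * d)%N]mulnC PoszD legendreDMp natrD mulrDl divff ?sawtoothD1 //.
  by rewrite natrM mulf_neq0.
rewrite mulr_sumr; apply: eq_bigr => t _.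
rewrite addnC PoszD [(p * l)%N]mulnC legendreDMp PoszM legendreM // intrM mulrA.
rewrite [(legendre p d)%:~R * _]mulrC; congr (_ * sawtooth _).
by rewrite natrD !natrM; field; rewrite p0' d0'.
Qed.

(** Writing both Bernoulli numbers as sawtooth sums over k and l leaves the sum over odd psi of
    psi(k) times the conjugate of psi(p l). Orthogonality keeps k = p l mod d with sign + and k = -p
    l mod d with sign -. Under l -> d - l the second part equals the first, which cancels the factor
    1/2. *)
Lemma sum_odd_dchar_bernoulli (d : nat) : (0 < d)%N -> ~~ (p %| d)%N ->
  \sum_(i : Iirr (units_Zp d) | odd_dchar i)
    (dchar i p)^*
    * bernoulli1 (p * d) (fun k : int => (legendre p k)%:~R * dchar i k)
    * bernoulli1 d (fun k : int => (dchar i k)^*) =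
  (totient d)%:R * (legendre p d)%:~R
  * ratr (\sum_(0 <= l < d | coprime l d)
            sawtooth (l%:R / d%:R) * legendre_sawtooth (l%:R / d%:R)) :> algC.
Proof.
move=> d0 pNd; have p0 := prime_gt0 p_prime.
have pd0 : (0 < p * d)%N by rewrite muln_gt0 p0.
have cop l : coprimez (p * l)%N d = coprime l d.
  by rewrite coprimezE /= coprimeMl prime_coprime // pNd.
pose C (k l : nat) : algC := ratr
  ((legendre p k)%:~R * sawtooth (k%:R / (p * d)%:R) * sawtooth (l%:R / d%:R)).
transitivity (\sum_(0 <= l < d) \sum_(0 <= k < p * d) C k l *
    \sum_(i : Iirr (units_Zp d) | odd_dchar i)
      dchar i k * (dchar i (p * l)%N)^*).
  under [RHS]eq_bigr do under eq_bigr do rewrite mulr_sumr.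
  under [RHS]eq_bigr do rewrite exchange_big.
  rewrite /= [RHS]exchange_big /=; apply: eq_bigr => i i_odd.
  have [fP _ fM _] := dcharP i d0.
  have fPn (k : int) (n : nat) : dchar i (k + (n * d)%N) = dchar i k.
    elim: n => [|n IHn]; first by rewrite addr0.
    by rewrite mulSnr PoszD [k + _]addrA fP.
  rewrite bernoulli1_sawtooth //; first last.
  - by move=> k; rewrite legendreN // dcharN // mulrN.
  - by move=> k; rewrite fPn mulnC legendreDMp.
  rewrite bernoulli1_sawtooth //; first last.
  - by move=> k; rewrite dcharN // rmorphN.
  - by move=> k; rewrite fP.
  rewrite mulr_sumr; apply: eq_bigr => l _.
  rewrite mulr_sumr mulr_suml; apply: eq_bigr => k _.
  rewrite PoszM fM /C !rmorphM /= ratr_int.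
  by ring.
under eq_bigr do under eq_bigr do rewrite sum_odd_dchar_conj // cop.
pose S (l : nat) : rat := (legendre p d)%:~R * legendre_sawtooth (l%:R / d%:R).
pose g (l : nat) : rat := (coprime l d)%:R * sawtooth (l%:R / d%:R).
have SE l : \sum_(0 <= k < p * d)
    ((d %| k%:Z - (p * l)%N%:Z)%Z%:R *
     ((legendre p k)%:~R * sawtooth (k%:R / (p * d)%:R)))
  = S l :> rat.
  rewrite /S -sum_legendre_class // [RHS]big_mkcond; apply: eq_bigr => k _.
  rewrite -eqz_mod_dvd !modz_nat eqz_nat.
  by case: ifP; rewrite ?mul1r ?mul0r.
(* Modulo [d], the class of -p l is that of p (d - l), so this part is again a value of [S]. *)
have SNE l : (l <= d)%N -> \sum_(0 <= k < p * d)
    ((d %| k%:Z + (p * l)%N%:Z)%Z%:R *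
     ((legendre p k)%:~R * sawtooth (k%:R / (p * d)%:R)))
  = S (d - l)%N :> rat.
  move=> ld; rewrite -SE; apply: eq_bigr => k _.
  congr (_%:R * _); congr nat_of_bool.
  have -> : k%:Z - (p * (d - l))%N%:Z = k%:Z + (p * l)%N%:Z - (p * d)%N%:Z.
    by rewrite mulnBr -subzn ?leq_mul //; ring.
  by rewrite rpredBr // PoszM dvdz_mull.
have -> : \sum_(0 <= l < d | coprime l d)
    sawtooth (l%:R / d%:R) * legendre_sawtooth (l%:R / d%:R) =
    \sum_(1 <= l < d) g l * legendre_sawtooth (l%:R / d%:R).
  rewrite big_mkcond /= big_ltn // /g mul0r sawtooth0 mul0r if_same add0r.
  by apply: eq_bigr => l _; case: ifP; rewrite ?mul1r ?mul0r.
transitivity ((totient d)%:R / 2 *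
  ratr (\sum_(1 <= l < d) g l * (S l - S (d - l)%N)) : algC).
  rewrite big_ltn // big1 ?add0r => [|k _]; last first.
    by rewrite /C mul0r sawtooth0 mulr0 [ratr 0]rmorph0 mul0r.
  rewrite rmorph_sum mulr_sumr; apply: eq_big_nat => l /andP[_ /ltnW ld].
  rewrite -SE -SNE // -sumrB rmorphM mulrA rmorph_sum mulr_sumr.
  apply: eq_bigr => k _; rewrite /C /g !(rmorphM, rmorphB) /= !ratr_nat ratr_int.
  by ring.
(* [g] is odd under l -> d - l, so the reflected sum changes sign and the difference doubles. *)
have revS : \sum_(1 <= l < d) g l * S (d - l)%N = - \sum_(1 <= l < d) g l * S l.
  rewrite -[LHS]sum_nat_rev1 -sumrN; apply: eq_big_nat => l /andP[l0 ld].
  have ld' := ltnW ld.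
  rewrite subKn // -mulNr; congr (_ * _).
  rewrite /g -mulrN -sawtoothN; congr (_ * _).
    have cE m n : coprime m (m + n) = coprime n (m + n).
      by rewrite /coprime gcdnDl addnC gcdnDl gcdnC.
    by have := cE (d - l)%N l; rewrite subnK // => ->.
  rewrite natrB // mulrBl divff ?pnatr_eq0 -?lt0n // addrC.
  by rewrite sawtoothD1.
under eq_bigr do rewrite mulrBr.
rewrite sumrB revS opprK.
have -> : \sum_(1 <= l < d) g l * S l =
   (legendre p d)%:~R * \sum_(1 <= l < d) g l * legendre_sawtooth (l%:R / d%:R).
  by rewrite mulr_sumr; apply: eq_bigr => l _; rewrite /S mulrCA.
by rewrite !(rmorphM, rmorphD) /= ratr_int; field.
Qed.
End TwistedSum.

(** * Digit sums *)

Section DigitSums.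
Variables p b : nat.
Hypotheses (p_prime : prime p) (p_odd : odd p) (p_mod4 : p = 1 %[mod 4]).
Hypothesis pNb : ~~ (p %| b)%N.
Hypothesis b_order : (p - 1 = 2 * #[unit_class p b]%g)%N.

Let p_gt0 : (0 < p)%N := prime_gt0 p_prime.
Let b_gt0 : (0 < b)%N.
Proof. by case: b pNb; rewrite ?dvdn0. Qed.
Let b_neq0 : (b%:R : rat) != 0.
Proof. by rewrite pnatr_eq0 -lt0n. Qed.

Let pNbt (t : nat) : (0 < t < p)%N -> ~~ (p %| b * t)%N.
Proof. by move=> /andP[t0 tp]; rewrite Euclid_dvdM // negb_or pNb gtnNdvd. Qed.

(** For t = b^j mod p this is the digit c_(j+1) minus the mean. *)
Let digit (t : nat) : rat := (b * t %/ p)%:R - (b%:R - 1) / 2.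

(** The left side of the key identity as a function of the shift; its value at 0 is s(1, b). *)
Let shift_sum (x : rat) : rat :=
  \sum_(0 <= l < b) sawtooth (l%:R / b%:R) * sawtooth (l%:R / b%:R + x).

(** Since chi is even, t -> p - t permutes the residues, and it negates the centred digit. *)
Lemma sum_residue_digit : \sum_(1 <= t < p | legendre p t == 1) digit t = 0.
Proof.
have: \sum_(1 <= t < p | legendre p t == 1) digit t =
    - \sum_(1 <= t < p | legendre p t == 1) digit t.
  rewrite big_mkcond /= -{1}sum_nat_rev1 -sumrN [RHS]big_mkcond.
  apply: eq_big_nat => t t_lt; have /andP[t0 tp] := t_lt.
  have -> : legendre p (p - t)%N = legendre p t.
    by rewrite -subzn 1?ltnW // addrC legendreDp // legendreN.
  case: ifP => // _; rewrite /digit.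
  (* The remainders of b t and b (p - t) mod p are nonzero and add up to p, so the quotients add up
     to b - 1. *)
  have dE : (b * (p - t) %/ p + b * t %/ p + 1 = b)%N.
    have := pNbt t_lt; rewrite /dvdn -lt0n.
    have := ltn_pmod (b * t) p_gt0; have := ltn_pmod (b * (p - t)) p_gt0.
    have := divn_eq (b * t) p; have := divn_eq (b * (p - t)) p.
    rewrite mulnBr; have : (b * t <= b * p)%N by rewrite leq_mul // ltnW.
    move: (_ %/ _)%N (_ %/ _)%N (_ %% _)%N (_ %% _)%N => x y r s.
    move: (b * t)%N => z; clear b_order; nia.
  by move/(congr1 (fun n => n%:R : rat)): dE; rewrite !natrD; lra.
by move/eqP; rewrite -addr_eq0 -mulr2n mulrn_eq0 => /eqP.
Qed.

Lemma shift_sum0 : shift_sum 0 = (b%:R - 1) * (b%:R - 2) / (12 * b%:R).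
Proof.
rewrite /shift_sum big_ltn // mul0r sawtooth0 mul0r add0r.
rewrite (eq_big_nat _ _ (F2 := fun l =>
  b%:R ^- 2 * l%:R ^+ 2 - b%:R^-1 * l%:R + 4^-1)) => [|l lb]; last first.
  by rewrite addr0 sawtooth_frac_lt //; field.
rewrite !big_split /= sumrN -!mulr_sumr.
have := sum_nat_id rat b; have := sum_nat_sqr rat b.
rewrite !(big_ltn b_gt0) expr0n !add0r => -> ->.
by rewrite sumr_const_nat -[_ *+ (b - 1)]mulr_natr natrB //; field.
Qed.

Lemma sum_shift_sum :
  \sum_(1 <= t < p) shift_sum (t%:R / p%:R) = dedekind_sum p b - shift_sum 0.
Proof.
have -> : \sum_(1 <= t < p) shift_sum (t%:R / p%:R) =
    \sum_(0 <= t < p) shift_sum (t%:R / p%:R) - shift_sum 0.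
  by rewrite [X in _ = X - _]big_ltn // mul0r [RHS]addrC addKr.
congr (_ - _); rewrite /shift_sum exchange_big /= big_ltn //.
rewrite big1 ?add0r => [|t _]; last by rewrite mul0r sawtooth0 mul0r.
by apply: eq_bigr => l _; rewrite -mulr_sumr sum_sawtooth_distrib.
Qed.

Lemma sum_legendre_shift_sum :
  \sum_(1 <= t < p) (legendre p t)%:~R * shift_sum (t%:R / p%:R) =
  \sum_(0 <= l < b) sawtooth (l%:R / b%:R) * legendre_sawtooth p (l%:R / b%:R).
Proof.
transitivity (\sum_(0 <= t < p) (legendre p t)%:~R * shift_sum (t%:R / p%:R)).
  by rewrite [RHS]big_ltn // legendre0 mul0r add0r.
rewrite /shift_sum /legendre_sawtooth.
under eq_bigr do rewrite mulr_sumr.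
rewrite exchange_big /=; apply: eq_bigr => l _; rewrite mulr_sumr.
by apply: eq_bigr => t _; rewrite mulrCA.
Qed.

(** For 0 < t < p, (1 + chi(t))/2 is the indicator of the residues. *)
Lemma sum_residueE (f : nat -> rat) :
  \sum_(1 <= t < p | legendre p t == 1) f t =
  2^-1 * (\sum_(1 <= t < p) f t + \sum_(1 <= t < p) (legendre p t)%:~R * f t).
Proof.
rewrite -big_split mulr_sumr big_mkcond; apply: eq_big_nat => t /andP[t0 tp].
rewrite /legendre dvdzE /= gtnNdvd //.
case: existsP => _; first by rewrite eqxx; field.
by have -> : (-1 == 1 :> int) = false by []; rewrite mulrN1z; field.
Qed.

(** By the key identity the square is 2b [shift_sum] (t/p) plus a constant. The trivial part and the
    constants make up the [T] term; the chi-part is the last sum. *)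
Lemma sum_residue_digit_sqr :
  \sum_(1 <= t < p | legendre p t == 1) digit t ^+ 2 =
  (p%:R - 1) / 2 * T b p + b%:R *
  \sum_(0 <= l < b) sawtooth (l%:R / b%:R) * legendre_sawtooth p (l%:R / b%:R).
Proof.
have -> : \sum_(1 <= t < p | legendre p t == 1) digit t ^+ 2 =
    \sum_(1 <= t < p | legendre p t == 1)
      (2 * b%:R * shift_sum (t%:R / p%:R) +
       (((b%:R - 1) / 2) ^+ 2 - 2 * b%:R * shift_sum 0)).
  rewrite big_nat_cond [RHS]big_nat_cond; apply: eq_bigr => t /andP[t_lt _].
  rewrite /shift_sum sum_sawtooth_digit ?pNbt // -/(shift_sum 0) shift_sum0.
  by rewrite -/(digit t); field.
rewrite big_split /= -mulr_sumr.
(* Resumming the constant over the powers of [b] counts the residues: their number is the order of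
   [b]. *)
rewrite -(sum_half_cycle (fun=> ((b%:R - 1) / 2) ^+ 2 - 2 * b%:R * shift_sum 0)
  p_prime pNb b_order).
rewrite sumr_const_nat subn0 sum_residueE sum_shift_sum sum_legendre_shift_sum.
rewrite shift_sum0 /T -[_ *+ _]mulr_natr.
have p1 : p%:R - 1 = 2 * (#[unit_class p b]%g)%:R :> rat.
  by rewrite -natrM -b_order natrB.
have -> : p%:R = 2 * (#[unit_class p b]%g)%:R + 1 :> rat by rewrite -p1 subrK.
by field; rewrite b_neq0 addrK mulf_neq0 // pnatr_eq0 -lt0n order_gt0.
Qed.
End DigitSums.

(** * Digits of the expansion of 1/p *)

(** The n-th partial sum is N_n / b^n with N_n the integer written by the first n digits, and the
    tail lies between 0 and b^-n. Hence N_n = floor(b^n / p), and the next digit is N_(n+1) - b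
    N_n. *)
Lemma expansion_digit (R : realType) (p b : nat) (c : nat -> nat) :
  (1 < p)%N -> coprime p b -> (0 < b)%N ->
  (forall j : nat, (1 <= j)%N -> (c j < b)%N) ->
  (fun n : nat => \sum_(1 <= j < n.+1) (c j)%:R / b%:R ^+ j : R) @ \oo
    --> (p%:R^-1 : R) ->
  forall n, c n.+1 = ((b * (b ^ n %% p)) %/ p)%N.
Proof.
move=> p1 pb b0 c_lt c_lim; have p0 : (0 < p)%N by apply: ltnW.
have b0' : (0 : R) < b%:R by rewrite ltr0n.
have p0' : (0 : R) < p%:R by rewrite ltr0n.
pose S n : R := \sum_(1 <= j < n.+1) (c j)%:R / b%:R ^+ j.
pose N := nat_rect (fun=> nat) 0%N (fun n m => b * m + c n.+1)%N.
have SS n : S n.+1 = S n + (c n.+1)%:R / b%:R ^+ n.+1.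
  by rewrite /S big_nat_recr.
have SN n : S n = (N n)%:R / b%:R ^+ n.
  elim: n => [|n IHn]; first by rewrite /S big_geq // mul0r.
  rewrite SS IHn /= natrD natrM exprS; field.
  by rewrite expf_neq0 // gt_eqF.
have S_ge n k : S n <= S (n + k)%N.
  elim: k => [|k IHk]; first by rewrite addn0.
  by rewrite addnS SS (le_trans IHk) // lerDl divr_ge0 // exprn_ge0 // ltW.
(* Digits are at most b - 1, so the upper bounds S_n + b^-n never increase. *)
have S_le n k : S (n + k)%N + b%:R ^- (n + k) <= S n + b%:R ^- n.
  elim: k => [|k IHk]; first by rewrite addn0.
  apply: le_trans IHk; rewrite addnS SS -addrA lerD2l.
  rewrite -[X in _ + X <= _]mul1r -mulrDl.
  rewrite ler_pdivrMr ?exprn_gt0 // exprS mulrCA mulVf ?mulr1; last first.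
    by rewrite expf_neq0 // gt_eqF.
  by rewrite natr1 ler_nat c_lt.
have lim_ge n : S n <= p%:R^-1.
  apply: (cvgr_to_ge c_lim); exists n => // k /= nk.
  by rewrite -(subnKC nk); exact: S_ge.
have lim_le n : p%:R^-1 <= S n + b%:R ^- n.
  apply: (cvgr_to_le c_lim); exists n => // k /= nk.
  apply: le_trans (S_le n (k - n)%N); rewrite subnKC //.
  by rewrite -[leLHS]addr0 lerD2l invr_ge0 exprn_ge0 // ltW.
have NE n : N n = (b ^ n %/ p)%N.
  have bn0 : (0 : R) < b%:R ^+ n by rewrite exprn_gt0.
  have le1 : (N n * p <= b ^ n)%N.
    have := lim_ge n; rewrite SN ler_pdivrMr // mulrC ler_pdivlMr //.
    by rewrite -natrX -natrM ler_nat.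
  have le2 : (b ^ n <= (N n).+1 * p)%N.
    have := lim_le n; rewrite SN -[X in _ + X]mul1r -mulrDl natr1.
    rewrite ler_pdivlMr // mulrC ler_pdivrMr //.
    by rewrite -natrX -natrM ler_nat.
  (* The limit yields only a weak upper bound; equality would make [p] divide b^n, against
     coprimality. *)
  have neq : (b ^ n != (N n).+1 * p)%N.
    apply/eqP => bE; have : coprime p (b ^ n) by rewrite coprimeXr.
    by rewrite bE coprimeMr /coprime gcdnn [p == _]gtn_eqF // andbF.
  have lt2 : (b ^ n < (N n).+1 * p)%N by rewrite ltn_neqAle neq.
  by apply/eqP; rewrite eqn_leq leq_divRL // le1 -ltnS ltn_divLR.
move=> n; have := NE n.+1; rewrite /= -/(N n) NE expnS {2}(divn_eq (b ^ n) p).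
by rewrite mulnDr mulnA divnMDl // => /addnI.
Qed.

(** * Assembly of the variance formula *)

Theorem theorem2 (R : realType) (p b : nat) (c : nat -> nat)
    (p_prime : prime p) (p_mod4 : p = 1 %[mod 4])
    (b_ge2 : (2 <= b)%N) (p_ndvd_b : ~~ (p %| b)%N)
    (b_order : #[unit_class p b]%g = ((p - 1) %/ 2)%N)
    (c_digit : forall j : nat, (1 <= j)%N -> (c j < b)%N)
    (c_expansion :
      (fun n : nat => \sum_(1 <= j < n.+1) (c j)%:R / b%:R ^+ j : R) @ \oo
        --> (p%:R^-1 : R)) :
  let q := ((p - 1) %/ 2)%N in
  let m : algC := q%:R^-1 * \sum_(1 <= j < q.+1) (c j)%:R in
  let sigma2 : algC := q%:R^-1 * \sum_(1 <= j < q.+1) ((c j)%:R - m) ^+ 2 in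
  sigma2 =
    ratr (T b p)
    + 2%:R * b%:R / (p%:R - 1)
      * \sum_(d <- divisors b)
          (legendre p d)%:~R / (totient d)%:R
          * \sum_(i : Iirr (units_Zp d) | odd_dchar i)
              (dchar i p)^*
              * bernoulli1 (p * d) (fun k : int => (legendre p k)%:~R * dchar i k)
              * bernoulli1 d (fun k : int => (dchar i k)^*).
Proof.
move=> q m sigma2.
have b0 : (0 < b)%N by apply: ltnW.
have p_gt0 := prime_gt0 p_prime.
have p_odd : odd p.
  by rewrite (divn_eq p 4) p_mod4 modn_small // oddD oddM andbF.
have p_order : (p - 1 = 2 * #[unit_class p b]%g)%N.
  by rewrite b_order mulnC divnK // dvdn2 oddB // p_odd.
have q0 : (0 < q)%N by rewrite /q -b_order order_gt0.
have q0' : (q%:R : algC) != 0 by rewrite pnatr_eq0 -lt0n.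
have pq : (p%:R - 1 = 2 * q%:R :> algC).
  by rewrite -natrM /q -b_order -p_order natrB.
have cE := expansion_digit (prime_gt1 p_prime) _ b0 c_digit c_expansion.
have {}cE j : c j.+1 = (b * (b ^ j %% p) %/ p)%N.
  by rewrite cE // prime_coprime.
have sum_c (h : nat -> rat) : \sum_(1 <= j < q.+1) h (c j) =
    \sum_(1 <= t < p | legendre p t == 1) h (b * t %/ p)%N.
  rewrite -(sum_half_cycle (fun t => h (b * t %/ p)%N)
    p_prime p_ndvd_b p_order) b_order.
  by rewrite big_add1 /=; apply: eq_bigr => j _; rewrite cE.
have mE : m = ratr ((b%:R - 1) / 2).
  have := sum_residue_digit p_prime p_odd p_mod4 p_ndvd_b.
  rewrite -(sum_c (fun x => x%:R - (b%:R - 1) / 2)) sumrB.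
  rewrite sumr_const_nat subSS subn0 /=.
  move/eqP; rewrite subr_eq0 => /eqP/(congr1 (ratr : rat -> algC)).
  rewrite rmorph_sum /= rmorphMn /= /m; under eq_bigr do rewrite ratr_nat.
  by move=> ->; rewrite -[ratr _ *+ q]mulr_natl mulKf.
have sE : sigma2 = q%:R^-1 * ratr ((p%:R - 1) / 2 * T b p + b%:R *
    \sum_(0 <= l < b) sawtooth (l%:R / b%:R) * legendre_sawtooth p (l%:R / b%:R)).
  rewrite -(sum_residue_digit_sqr p_prime p_ndvd_b p_order).
  rewrite -(sum_c (fun x => (x%:R - (b%:R - 1) / 2) ^+ 2)) rmorph_sum /=.
  congr (_ * _); apply: eq_bigr => j _.
  by rewrite mE rmorphXn rmorphB /= ratr_nat.
rewrite {}sE.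
rewrite -(sum_divisors_coprime (fun x => sawtooth x * legendre_sawtooth p x) b0).
(* This factor cancels the 1/q in front of [T], while b/q becomes 2b/(p - 1). *)
have -> : (p%:R - 1) / 2 = q%:R :> rat.
  have -> : p%:R - 1 = 2 * q%:R :> rat.
    by rewrite -natrM /q -b_order -p_order natrB.
  by rewrite mulrC mulKf.
rewrite rmorphD !rmorphM /= !ratr_nat rmorph_sum pq /=.
have -> : \sum_(d <- divisors b)
    ratr (\sum_(0 <= l < d | coprime l d)
      sawtooth (l%:R / d%:R) * legendre_sawtooth p (l%:R / d%:R)) =
  \sum_(d <- divisors b)
          (legendre p d)%:~R / (totient d)%:R
          * \sum_(i : Iirr (units_Zp d) | odd_dchar i)
              (dchar i p)^*
              * bernoulli1 (p * d) (fun k : int => (legendre p k)%:~R * dchar i k)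
              * bernoulli1 d (fun k : int => (dchar i k)^*) :> algC.
  rewrite big_seq [RHS]big_seq; apply: eq_bigr => d.
  rewrite -dvdn_divisors // => db.
  have d0 : (0 < d)%N by apply: dvdn_gt0 db.
  have pNd : ~~ (p %| d)%N by apply: contra p_ndvd_b => /dvdn_trans; apply.
  rewrite sum_odd_dchar_bernoulli //.
  (* The character sum brings a second factor chi(d), and the two cancel because [p] does not divide
     [d]. *)
  have chi2 : (legendre p d)%:~R ^+ 2 = 1 :> algC.
    by rewrite expr2 -intrM -expr2 legendre_sqr // dvdzE.
  have phi0 : (totient d)%:R != 0 :> algC by rewrite pnatr_eq0 -lt0n totient_gt0.
  by rewrite !mulrA divfK // -expr2 chi2 mul1r.
by field.
Qed.
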